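(* For every integer $n\geq 0$, $\bar{p}(40n+35)\equiv 0 \pmod{5}$.
   Context: An overpartition of a positive integer $n$ is a partition of $n$ in which the first occurrence of each distinct part may be overlined; $\bar{p}(n)$ is the number of overpartitions of $n$ for $n\geq 1$, and $\bar{p}(0)=1$. Equivalently, $\sum_{n\geq 0}\bar{p}(n)q^n=\prod_{k\geq 1}\frac{1+q^k}{1-q^k}$. *)

(* Defs.v *)
From mathcomp Require Import all_boot.
Set Implicit Arguments. Unset Strict Implicit. Unset Printing Implicit Defensive.

(* parts_le m n : all partitions of n into parts of size at most m,
   each listed as a nonincreasing sequence of positive parts. *)
Fixpoint parts_le (fuel m n : nat) : seq (seq nat) :=
  match fuel with
  | 0 => if n == 0 then [:: [::]] else [::]
  | fuel'.+1 =>
    if n == 0 then [:: [::]] else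
    flatten [seq [seq k :: l | l <- parts_le fuel' k (n - k)]
            | k <- iota 1 (minn m n)]
  end.

Definition partitions (n : nat) : seq (seq nat) := parts_le n n n.

(* An overpartition of n is a partition of n in which the first occurrence
   of each distinct part may be overlined: for a partition with d distinct
   parts there are 2^d overpartitions.  pbar n counts them (pbar 0 = 1). *)
Definition pbar (n : nat) : nat :=
  sumn [seq 2 ^ size (undup l) | l <- partitions n].

Lemma pbar_small :
  [seq pbar n | n <- iota 0 9] = [:: 1; 2; 4; 8; 14; 24; 40; 64; 100].
Proof. by vm_compute. Qed.

(* Main.v *)
Require Import Defs.
From mathcomp Require Import all_boot all_algebra zify ring.
Set Implicit Arguments. Unset Strict Implicit. Unset Printing Implicit Defensive.
Import GRing.Theory.

(** Write phi(-q) for the sum of (-1)^k q^(k^2) over all integers k. Gauss's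
    product formula phi(-q) = prod (1 - q^k) / (1 + q^k), the limit of a finite
    Jacobi triple product, says that the generating function of pbar is
    1 / phi(-q). Modulo 5,
      1 / phi(-q) = phi(-q)^4 / phi(-q)^5 = phi(-q)^4 / phi(-q^5),
    so extracting the exponents divisible by 5 gives
      sum pbar(5n) q^n = (sum (-1)^n r_4(5n) q^n) / phi(-q).
    Factoring integral quaternions of norm 5n through the six quaternions
    1 +- 2i, 1 +- 2j, 1 +- 2k of norm 5 shows r_4(5n) = r_4(n) mod 5, hence the
    right-hand side is phi(-q)^3 and pbar(5n) = (-1)^n r_3(n) mod 5. Finally
    40n + 35 = 5(8n + 7), and 8n + 7 is not a sum of three squares.

    Power series are handled as polynomials up to [eq_trunc K], equality of the
    coefficients of degree less than K. *)

(** * Overpartitions with bounded parts *)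

Definition weight (l : seq nat) : nat := 2 ^ size (undup l).

(** Each recursive call removes a part k >= 1 from n, so any fuel of at least n lets the recursion
    finish. *)
Lemma parts_le_fuel f f' m n : n <= f -> n <= f' -> parts_le f m n = parts_le f' m n.
Proof.
elim: f f' m n => [|f ih] [|f'] m n //=.
- by rewrite leqn0 => /eqP ->.
- by move=> _; rewrite leqn0 => /eqP ->.
move=> hf hf'; case: eqP => // n0.
congr flatten; apply/eq_in_map => k; rewrite mem_iota => hk.
by rewrite (ih f') //; lia.
Qed.

Lemma parts_le_bound f m n l : l \in parts_le f m n -> all (fun k => k <= m) l.
Proof.
elim: f m n l => [|f ih] m n l /=; first by case: eqP => // _; rewrite inE => /eqP ->.
case: eqP => [_|_]; first by rewrite inE => /eqP ->.
case/flatten_mapP => k; rewrite mem_iota => hk /mapP [l' /ih hl ->] /=.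
apply/andP; split; first lia.
by apply: sub_all hl => i; lia.
Qed.

Lemma weight_cons_new f m n l :
  l \in parts_le f m n -> weight (m.+1 :: l) = 2 * weight l.
Proof.
move=> hl; rewrite /weight /=; case: ifP => [hm|_]; last by rewrite /= expnS.
by have /allP /(_ _ hm) := parts_le_bound hl; rewrite ltnn.
Qed.

(* The parameter m bounds the parts; [oparts_cons k] counts the overpartitions
   with largest part k, by the size n of what remains after removing one k. *)
Definition oparts (m n : nat) : nat := \sum_(l <- parts_le n m n) weight l.
Definition oparts_cons (k n : nat) : nat := \sum_(l <- parts_le n k n) weight (k :: l).

Lemma pbarE n : pbar n = oparts n n.
Proof. by rewrite /pbar /oparts /partitions sumnE big_map. Qed.

Lemma opartsn0 m : oparts m 0 = 1.
Proof. by rewrite /oparts /= big_seq1. Qed.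

Lemma oparts_sum m n : 0 < n ->
  oparts m n = \sum_(k <- iota 1 (minn m n)) oparts_cons k (n - k).
Proof.
case: n => // n _; rewrite /oparts /= big_flatten big_map.
rewrite big_seq [RHS]big_seq; apply: eq_bigr => k; rewrite mem_iota => hk.
by rewrite big_map /oparts_cons (@parts_le_fuel n (n.+1 - k)) //; lia.
Qed.

Lemma oparts0n n : 0 < n -> oparts 0 n = 0.
Proof. by move=> h; rewrite oparts_sum // min0n big_nil. Qed.

Lemma oparts_small m n : n < m.+1 -> oparts m.+1 n = oparts m n.
Proof.
case: n => [|n] h; first by rewrite !opartsn0.
by rewrite !oparts_sum // (_ : minn m.+1 n.+1 = minn m n.+1) //; lia.
Qed.

Lemma opartsS m n : m < n -> oparts m.+1 n = oparts m n + oparts_cons m.+1 (n - m.+1).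
Proof.
move=> h; rewrite !oparts_sum; [|lia|lia].
have [-> ->] : minn m.+1 n = m + 1 /\ minn m n = m by lia.
by rewrite iotaD big_cat big_seq1 /= add1n.
Qed.

(** If the remainder has no part m+1, the removed one is a new distinct part, overlined or not,
    whence the factor 2; otherwise it repeats a part and leaves the weight unchanged. *)
Lemma oparts_consS m n : m < n ->
  oparts_cons m.+1 n = 2 * oparts m n + oparts_cons m.+1 (n - m.+1).
Proof.
move=> h.
have split_parts : parts_le n m.+1 n =
    parts_le n m n ++ [seq m.+1 :: l | l <- parts_le (n - m.+1) m.+1 (n - m.+1)].
  case: n h => // n h /=.
  have [-> ->] : minn m.+1 n.+1 = m + 1 /\ minn m n.+1 = m by lia.
  rewrite iotaD map_cat flatten_cat /= cats0 add1n.
  by rewrite (@parts_le_fuel n (n.+1 - m.+1)) //; lia.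
rewrite {1}/oparts_cons split_parts big_cat big_map /=; congr (_ + _).
- rewrite /oparts big_distrr /= big_seq [RHS]big_seq; apply: eq_bigr => l hl.
  exact: weight_cons_new hl.
- by apply: eq_bigr => l _; rewrite /weight /= inE eqxx.
Qed.

Lemma oparts_cons_small m n : n < m.+1 -> oparts_cons m.+1 n = 2 * oparts m n.
Proof.
move=> h; rewrite /oparts_cons /oparts.
have -> : parts_le n m.+1 n = parts_le n m n.
  by case: n h => //= n h; rewrite (_ : minn m.+1 n.+1 = minn m n.+1) //; lia.
rewrite big_distrr /= big_seq [RHS]big_seq; apply: eq_bigr => l hl.
exact: weight_cons_new hl.
Qed.

(** Coefficient form of (1 - q^(m+1)) F_(m+1) = (1 + q^(m+1)) F_m, with F_m the generating function
    of [oparts m]. *)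
Lemma oparts_rec m n : m < n ->
  oparts m.+1 n = oparts m n + oparts m (n - m.+1) + oparts m.+1 (n - m.+1).
Proof.
move=> h; rewrite opartsS //.
have [hs|hs] := ltnP m (n - m.+1).
  by rewrite oparts_consS // (opartsS hs); lia.
by rewrite oparts_cons_small // (oparts_small hs); lia.
Qed.

Lemma oparts_ge m n : n <= m -> oparts m n = pbar n.
Proof.
rewrite pbarE; elim: m => [|m ih] h; first by move: h; rewrite leqn0 => /eqP ->.
move: h; rewrite leq_eqVlt => /orP [/eqP -> //|h].
by rewrite oparts_small ?ih.
Qed.

Local Open Scope ring_scope.

(** * Truncated power series and Gauss's identity *)

Section TruncatedPolynomials.
Variable R : comNzRingType.
Implicit Types p q u : {poly R}.

Definition eq_trunc (K : nat) p q := forall i, (i < K)%N -> p`_i = q`_i.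

Lemma eq_trunc_refl K p : eq_trunc K p p. Proof. by []. Qed.

Lemma eq_trunc_sym K p q : eq_trunc K p q -> eq_trunc K q p.
Proof. by move=> h i /h. Qed.

Lemma eq_trunc_trans K q p r : eq_trunc K p q -> eq_trunc K q r -> eq_trunc K p r.
Proof. by move=> h h' i hi; rewrite h ?h'. Qed.

Lemma eq_truncM K p p' q q' :
  eq_trunc K p p' -> eq_trunc K q q' -> eq_trunc K (p * q) (p' * q').
Proof.
move=> hp hq i hi; rewrite !coefM; apply: eq_bigr => j _.
by rewrite hp ?hq //; have := ltn_ord j; lia.
Qed.

Lemma eq_truncMl K u p q : eq_trunc K p q -> eq_trunc K (u * p) (u * q).
Proof. exact: eq_truncM. Qed.

(** As u has constant term 1, the coefficient of degree i in u p is that of p plus a combination of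
    lower coefficients of p: strong induction on i. *)
Lemma eq_trunc_cancel K u p q :
  u`_0 = 1 -> eq_trunc K (u * p) (u * q) -> eq_trunc K p q.
Proof.
move=> u0 h; elim/ltn_ind => i ih hi; have := h i hi.
rewrite !coefM !big_ord_recl u0 !mul1r !subn0.
rewrite (eq_bigr (fun j : 'I_i => u`_(lift ord0 j) * q`_(i - lift ord0 j)));
  last first.
  by move=> j _; rewrite ih // lift0; have := ltn_ord j; lia.
by move/addIr.
Qed.

Lemma eq_truncXn K k p q : (K <= k)%N -> eq_trunc K ('X^k * p) ('X^k * q).
Proof.
by move=> hk i hi; rewrite !coefXnM (_ : (i < k)%N = true) //; lia.
Qed.

Lemma eq_trunc_sum K (I : Type) (s : seq I) (P : pred I) (f g : I -> {poly R}) :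
  (forall i, P i -> eq_trunc K (f i) (g i)) ->
  eq_trunc K (\sum_(i <- s | P i) f i) (\sum_(i <- s | P i) g i).
Proof. by move=> h i hi; rewrite !coef_sum; apply: eq_bigr => j hj; apply: h. Qed.

End TruncatedPolynomials.

(** * Gaussian binomial coefficients and the q-binomial theorem *)

Section QBinomial.
Variables (R : comNzRingType) (Q : R).

Definition qfact (n : nat) : R := \prod_(i < n) (1 - Q ^+ i.+1).

Lemma qfactS n : qfact n.+1 = qfact n * (1 - Q ^+ n.+1).
Proof. by rewrite /qfact big_ord_recr. Qed.

(** Gaussian binomials through the q-Pascal rule, hence division-free in any ring. Where m' - j'
    truncates, it meets a vanishing coefficient. *)
Fixpoint qbin (m j : nat) : R :=
  match m, j with
  | _, 0 => 1
  | 0, _.+1 => 0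
  | m'.+1, j'.+1 => qbin m' j'.+1 + Q ^+ (m' - j') * qbin m' j'
  end.

Lemma qbin0 m : qbin m 0 = 1. Proof. by case: m. Qed.

Lemma qbinS m j : qbin m.+1 j.+1 = qbin m j.+1 + Q ^+ (m - j) * qbin m j.
Proof. by []. Qed.

Lemma qbin_small m j : (m < j)%N -> qbin m j = 0.
Proof.
elim: m j => [|m ih] [|j] //= h.
by rewrite !ih ?mulr0 ?addr0 //; lia.
Qed.

Lemma qbinn m : qbin m m = 1.
Proof. by elim: m => //= m ->; rewrite qbin_small // subnn expr0 mul1r add0r. Qed.

Lemma qbin_fact i j : qbin (i + j) j * (qfact i * qfact j) = qfact (i + j).
Proof.
have q0 : qfact 0 = 1 by rewrite /qfact big_ord0.
elim: i j => [|i ihi]; first by move=> j; rewrite add0n qbinn q0 !mul1r.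
elim=> [|j ihj]; first by rewrite qbin0 addn0 q0 mulr1 mul1r.
rewrite addnS qbinS.
have -> : (i.+1 + j - j = i.+1)%N by lia.
have := ihi j.+1; rewrite addnS -addSn => h1.
have -> : qfact (i.+1 + j).+1 = qfact (i.+1 + j) * (1 - Q ^+ i.+1 * Q ^+ j.+1).
  by rewrite qfactS -exprD addnS.
transitivity ((1 - Q ^+ i.+1) * (qbin (i.+1 + j) j.+1 * (qfact i * qfact j.+1))
  + Q ^+ i.+1 * (1 - Q ^+ j.+1) * (qbin (i.+1 + j) j * (qfact i.+1 * qfact j))).
  by rewrite !qfactS; ring.
by rewrite h1 ihj; ring.
Qed.

(** The homogeneous form in y and z lets y be a power of X, so that the triple product is reached
    without negative exponents. *)
Lemma q_binomial (y z : R) m :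
  \prod_(i < m) (y + z * Q ^+ i) =
  \sum_(j < m.+1) Q ^+ 'C(j, 2) * qbin m j * z ^+ j * y ^+ (m - j).
Proof.
elim: m => [|m ih].
  by rewrite big_ord0 big_ord1 /= !expr0 !mulr1.
rewrite big_ord_recr /= ih mulrDr.
rewrite [in RHS]big_ord_recl /= bin0n expr0 !mul1r subn0.
under [in RHS]eq_bigr => j _.
  rewrite /bump /= add1n mulrDr !mulrDl subSS.
  over.
rewrite big_split /= addrA; congr (_ + _).
- rewrite big_distrl /= big_ord_recl /= bin0n expr0 !mul1r subn0 qbin0 mul1r.
  rewrite exprSr; congr (_ + _); first by rewrite mul1r.
  rewrite [in RHS]big_ord_recr /= qbin_small // mulr0 !mul0r addr0.
  apply: eq_bigr => j _; rewrite /bump /= add1n add0n -!mulrA -exprSr.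
  by rewrite subnSK.
- rewrite big_distrl /=; apply: eq_bigr => j _.
  rewrite add0n binS bin1 exprD.
  have -> : Q ^+ m = Q ^+ j * Q ^+ (m - j).
    by rewrite -exprD subnKC // -ltnS.
  by rewrite exprS; ring.
Qed.
End QBinomial.

Definition zrange (n : nat) : seq int := [seq j%:Z - n%:Z | j <- iota 0 n.*2.+1].

Lemma mem_zrange n k : (k \in zrange n) = (`|k| <= n)%N.
Proof.
apply/mapP/idP => [[j]|h]; first by rewrite mem_iota => ? ->; lia.
by exists (absz (k + n%:Z)); rewrite ?mem_iota; lia.
Qed.

Lemma zrange_uniq n : uniq (zrange n).
Proof. by rewrite map_inj_uniq ?iota_uniq // => i j; lia. Qed.

Section Gauss.
Variable R : comNzRingType.

Definition theta (n : nat) : {poly R} :=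
  \sum_(k <- zrange n) (-1) ^+ `|k| * 'X^(`|k| ^ 2).

Lemma thetaE n : theta n =
  \sum_(j < n.*2.+1) (-1) ^+ `|j%:Z - n%:Z| * 'X^(`|j%:Z - n%:Z| ^ 2).
Proof. by rewrite /theta big_map -[iota _ _]/(index_iota 0 n.*2.+1) big_mkord. Qed.

Definition oddfact (n : nat) : {poly R} := \prod_(i < n) (1 - 'X^(i.*2.+1)).
Definition plusfact (n : nat) : {poly R} := \prod_(i < n) (1 + 'X^(i.+1)).

(* The q-binomial theorem with Q = X^2, y = X^(2N-1), z = -1, after cancelling
   a factor X^(3N^2-2N). *)
Lemma finite_jacobi N :
  \sum_(j < N.*2.+1)
     (-1) ^+ `|j%:Z - N%:Z| * 'X^(`|j%:Z - N%:Z| ^ 2) * qbin ('X^2 : {poly R}) N.*2 j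
  = oddfact N ^+ 2.
Proof.
have [->|N0] := posnP N.
  by rewrite big_ord1 /oddfact big_ord0 /= !expr0 expr1n !mulr1.
have := q_binomial ('X^2 : {poly R}) ('X^(N.*2.-1)) (-1) N.*2.
have -> : \prod_(i < N.*2) ('X^(N.*2.-1) + -1 * 'X^2 ^+ i) =
   (-1) ^+ N * ('X^(3 * N ^ 2 - 2 * N) * oddfact N ^+ 2) :> {poly R}.
  (* In the first N factors the exponent 2i is below 2N-1, so -X^(2i) comes out; in the last N,
     X^(2N-1) comes out. Each half leaves [oddfact N]. *)
  rewrite -addnn big_split_ord /= addnn.
  have -> : \prod_(i < N) ('X^(N.*2.-1) + -1 * 'X^2 ^+ i) =
      (-1) ^+ N * ('X^(N * N.-1) * oddfact N) :> {poly R}.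
    have -> : \prod_(i < N) ('X^(N.*2.-1) + -1 * 'X^2 ^+ i) =
      \prod_(i < N) (-1 * 'X^2 ^+ i * (1 - 'X^((N - i.+1).*2.+1))) :> {poly R}.
      apply: eq_bigr => i _; rewrite mulrBr mulr1 -mulrA -exprM -exprD.
      rewrite !mulN1r opprK addrC; congr (_ + 'X^_).
      by have := ltn_ord i; lia.
    rewrite !big_split /= prodr_const card_ord -mulrA; congr (_ * (_ * _)).
      elim: {N0} N => [|M ih]; first by rewrite big_ord0.
      rewrite big_ord_recr /= ih -exprM -exprD; congr 'X^_.
      by case: M {ih} => //= M; lia.
    by rewrite /oddfact [RHS](reindex_inj rev_ord_inj).
  have -> : \prod_(i < N) ('X^(N.*2.-1) + -1 * 'X^2 ^+ (N + i)) =
      'X^(N * N.*2.-1) * oddfact N :> {poly R}.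
    have -> : 'X^(N * N.*2.-1) = \prod_(i < N) 'X^(N.*2.-1) :> {poly R}.
      by rewrite prodr_const card_ord -exprM mulnC.
    rewrite -big_split; apply: eq_bigr => i _.
    rewrite /= mulrBr mulr1 mulN1r -exprM -exprD.
    by congr (_ - 'X^_); lia.
  rewrite expr2 -!mulrA; congr (_ * _).
  have -> : (3 * N ^ 2 - 2 * N = N * N.-1 + N * N.*2.-1)%N by nia.
  by rewrite exprD; ring.
move/(congr1 (fun p => (-1) ^+ N * p)); rewrite mulrA -expr2 sqrr_sign mul1r.
rewrite mulr_sumr => h.
apply: (@GRing.lregX _ 'X (3 * N ^ 2 - 2 * N)).
  by apply: lreg_lead; rewrite lead_coefX; apply: lreg1.
rewrite h mulr_sumr; apply: eq_bigr => j _.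
have hj := ltn_ord j.
have hs : (-1) ^+ `|j%:Z - N%:Z| = (-1) ^+ N * (-1) ^+ j :> {poly R}.
  rewrite -exprD -signr_odd -[RHS]signr_odd; congr (_ ^+ nat_of_bool _); lia.
(* Completing the square: j(j-1) + (2N-1)(2N-j) = 3N^2 - 2N + (j-N)^2. *)
have hx : (2 * 'C(j, 2) + N.*2.-1 * (N.*2 - j) =
           3 * N ^ 2 - 2 * N + `|j%:Z - N%:Z| ^ 2)%N.
  rewrite -mul_bin_diag bin1; move: (val j) hj => i; nia.
rewrite hs -!exprM.
transitivity ((-1) ^+ N * (-1) ^+ j * 'X^(2 * 'C(j, 2) + N.*2.-1 * (N.*2 - j)) *
  qbin ('X^2 : {poly R}) N.*2 j); last by rewrite exprD; ring.
by rewrite hx exprD; ring.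
Qed.

Lemma qfactX_coef0 k n : (qfact ('X^(k.+1) : {poly R}) n)`_0 = 1.
Proof.
rewrite /qfact; elim: n => [|n ih]; first by rewrite big_ord0 coef1.
by rewrite big_ord_recr /= coef0M ih mul1r -exprM coefB coef1 coefXn /= subr0.
Qed.

Lemma qfactX_trunc K k n m : (K <= n)%N -> (K <= m)%N ->
  eq_trunc K (qfact ('X^(k.+1) : {poly R}) n) (qfact 'X^(k.+1) m).
Proof.
suff h n' : (K <= n')%N ->
    eq_trunc K (qfact ('X^(k.+1) : {poly R}) n') (qfact 'X^(k.+1) K).
  by move=> /h hn /h /eq_trunc_sym; apply: eq_trunc_trans hn.
elim: n' => [|n' ih]; first by case: K.
rewrite leq_eqVlt => /orP [/eqP <- //|hn].
apply: eq_trunc_trans (ih hn); rewrite qfactS -[X in eq_trunc _ _ X]mulr1.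
apply: eq_truncMl => i hi; rewrite coefB -exprM coefXn.
have -> : (i == k.+1 * n'.+1)%N = false by apply/eqP; nia.
by rewrite subr0.
Qed.

Lemma oddfact_qfact n : qfact ('X^2 : {poly R}) n * oddfact n = qfact 'X n.*2.
Proof.
elim: n => [|n ih]; first by rewrite /qfact /oddfact !big_ord0 mulr1.
rewrite doubleS !qfactS -ih /oddfact big_ord_recr /= -exprM.
have -> : (2 * n.+1 = n.*2.+2)%N by lia.
by ring.
Qed.

Lemma plusfact_qfact n : qfact ('X : {poly R}) n * plusfact n = qfact 'X^2 n.
Proof.
rewrite /qfact /plusfact -big_split; apply: eq_bigr => i _ /=.
by rewrite -exprM mul2n -addnn exprD; ring.
Qed.

Lemma theta_plusfact K n : (K.*2 <= n)%N ->
  eq_trunc K (theta n * plusfact n) (qfact ('X : {poly R}) n).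
Proof.
move=> hn.
have e2 := qfactX_coef0 1; have e1 := qfactX_coef0 0.
(* Limit of [finite_jacobi]: below degree K, [qfact 'X^2 n] times each relevant q-binomial is 1. *)
have h1 : eq_trunc K (theta n) (qfact ('X^2 : {poly R}) n * oddfact n ^+ 2).
  rewrite -finite_jacobi mulr_sumr thetaE; apply: eq_trunc_sum => j _.
  rewrite mulrCA -mulrA; apply: eq_truncMl.
  rewrite -[X in eq_trunc _ X _]mulr1.
  have [hK|hK] := leqP K (`|j%:Z - n%:Z| ^ 2); first exact: eq_truncXn.
  apply: eq_truncMl; apply: eq_trunc_sym.
  (* Since n >= 2K, this puts both j and 2n-j above K, where the finite products have stabilised. *)
  have hd : (`|j%:Z - n%:Z| < K)%N by nia.
  apply: (@eq_trunc_cancel _ _ (qfact 'X^2 n)) => //.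
  have := qbin_fact ('X^2 : {poly R}) (n.*2 - j) j.
  rewrite subnK; last by rewrite -ltnS.
  move=> h; rewrite mulr1.
  apply: eq_trunc_trans (_ : eq_trunc K (qfact 'X^2 n.*2) _); last first.
    by apply: qfactX_trunc; lia.
  rewrite -h [X in eq_trunc _ X _]mulrA [X in eq_trunc _ X _]mulrC; apply: eq_truncMl.
  by apply: eq_truncM; apply: qfactX_trunc; lia.
(* Euler's identity between odd parts and distinct parts. *)
have h2 : eq_trunc K (oddfact n * plusfact n) 1.
  apply: (@eq_trunc_cancel _ _ (qfact ('X^1 : {poly R}) n)) => //.
  rewrite mulrCA mulrC plusfact_qfact oddfact_qfact mulr1.
  by apply: (@qfactX_trunc K 0); lia.
apply: eq_trunc_trans (eq_truncM h1 (eq_trunc_refl _)) _.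
rewrite expr2 mulrA oddfact_qfact -mulrA -[X in eq_trunc _ _ X]mulr1.
by apply: eq_truncM h2; apply: (@qfactX_trunc K 0); lia.
Qed.

End Gauss.

(** * Generating function of overpartitions *)

Section GeneratingFunction.
Variable R : comNzRingType.

Definition opoly (K m : nat) : {poly R} := \poly_(i < K) (oparts m i)%:R.

Lemma opolyS K m :
  eq_trunc K ((1 - 'X^(m.+1)) * opoly K m.+1) ((1 + 'X^(m.+1)) * opoly K m).
Proof.
move=> i hi; rewrite mulrBl mulrDl !mul1r coefB coefD !coefXnM !coef_poly hi.
have [hm|hm] := ltnP i m.+1; first by rewrite subr0 addr0 oparts_small.
rewrite oparts_rec // !natrD; have -> : (i - m.+1 < K)%N by lia.
by rewrite addrK.
Qed.

Lemma qfact_opoly K m :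
  eq_trunc K (qfact ('X : {poly R}) m * opoly K m) (plusfact R m).
Proof.
elim: m => [|m ih].
  rewrite /qfact /plusfact !big_ord0 mul1r => i hi.
  rewrite coef_poly hi coef1; case: i hi => [|i] hi; first by rewrite opartsn0.
  by rewrite oparts0n.
rewrite qfactS -mulrA.
apply: eq_trunc_trans (eq_truncMl (qfact 'X m) (@opolyS K m)) _.
by rewrite mulrCA mulrC /plusfact big_ord_recr /=; apply: eq_truncM.
Qed.

Lemma theta_opoly K n : (K.*2 <= n)%N -> eq_trunc K (theta R n * opoly K n) 1.
Proof.
move=> hn; apply: (@eq_trunc_cancel _ _ (qfact ('X^1 : {poly R}) n)).
  exact: qfactX_coef0.
rewrite mulrCA mulr1.
apply: eq_trunc_trans (theta_plusfact R hn).
by apply: eq_truncMl; apply: qfact_opoly.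
Qed.

End GeneratingFunction.

(** * Extraction of exponents divisible by d, and the Frobenius map *)

Section Dissection.
Variables (R : comNzRingType) (d : nat).
Hypothesis d_gt0 : (0 < d)%N.

(** The length [size p] loses nothing, because d * i >= i for positive d. *)
Definition dissect (p : {poly R}) : {poly R} := \poly_(i < size p) p`_(d * i).

Lemma coef_dissect p i : (dissect p)`_i = p`_(d * i).
Proof.
rewrite coef_poly; case: ltnP => // h; rewrite nth_default //.
by apply: leq_trans h _; rewrite leq_pmull.
Qed.

Lemma dissectM (p q : {poly R}) : dissect (p * (q \Po 'X^d)) = dissect p * q.
Proof.
elim/poly_ind: q => [|q c ih].
  by rewrite comp_poly0 !mulr0; apply/polyP => i; rewrite coef_dissect !coef0.
apply/polyP => i; rewrite coef_dissect comp_poly_MXaddC !mulrDr !mulrA !coefD.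
rewrite !coefMC coef_dissect -ih coefMXn coefMX coef_dissect; congr (_ + _).
case: i => [|i]; first by rewrite muln0 d_gt0.
by rewrite mulnS ltnNge leq_addr /= addKn.
Qed.

End Dissection.

(** In characteristic p the p-th power is additive and fixes the coefficients 1 and -1. *)
Lemma theta_frobenius p n : prime p ->
  theta 'F_p n ^+ p = theta 'F_p n \Po 'X^p.
Proof.
move=> p_pr; have hp : p \in [pchar {poly 'F_p}] by rewrite pchar_poly pchar_Fp.
rewrite -(pFrobenius_autE hp) /theta !raddf_sum /=; apply: eq_bigr => k _.
rewrite pFrobenius_autE exprMn -['X^_ ^+ p]exprM [(_ * p)%N]mulnC [in X in _ * X]exprM.
rewrite comp_polyM comp_Xn_poly; congr (_ * _).
by rewrite -(pFrobenius_autE hp) !rmorphXn !rmorphN1.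
Qed.

(** * Sums of four squares modulo 5 *)

(** Hamilton's product on a + bi + cj + dk. The ring is a parameter because both integers and
    residues mod 5 occur. *)
Definition qmul (R : pzRingType) (x y : R * R * R * R) : R * R * R * R :=
  let: (a, b, c, d) := x in let: (a', b', c', d') := y in
  (a * a' - b * b' - c * c' - d * d', a * b' + b * a' + c * d' - d * c',
   a * c' - b * d' + c * a' + d * b', a * d' + b * c' - c * b' + d * a').

Definition qsqnorm (R : pzRingType) (x : R * R * R * R) : R :=
  let: (a, b, c, d) := x in a ^+ 2 + b ^+ 2 + c ^+ 2 + d ^+ 2.

Definition qconj (R : pzRingType) (x : R * R * R * R) : R * R * R * R :=
  let: (a, b, c, d) := x in (a, - b, - c, - d).

Definition norm5 (R : pzRingType) : seq (R * R * R * R) :=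
  [:: (1, 2%:R, 0, 0); (1, - 2%:R, 0, 0); (1, 0, 2%:R, 0);
      (1, 0, - 2%:R, 0); (1, 0, 0, 2%:R); (1, 0, 0, - 2%:R)].

Definition all5 : seq 'F_5 := [:: 0; 1; 2%:R; 3%:R; 4%:R].
Lemma all5P (x : 'F_5) : x \in all5.
Proof. by case: x; do 5?case=> //. Qed.

(** Quaternions over ['F_5] form the ring of 2 x 2 matrices. The images of the six p are the six
    lines of the plane, and a nonzero singular x kills exactly one line. The proof is a check of all
    quadruples. *)
Lemma count_norm5 (x : 'F_5 * 'F_5 * 'F_5 * 'F_5) : qsqnorm x = 0 ->
  count (fun p => qmul x p == (0, 0, 0, 0)) (norm5 'F_5) = 1 %[mod 5].
Proof.
case: x => [[[a b] c] d] /eqP h; apply/eqP; move: h; apply/implyP.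
have : all (fun a => all (fun b => all (fun c => all (fun d =>
    (qsqnorm (a, b, c, d) == 0) ==>
    (count (fun p => qmul (a, b, c, d) p == (0, 0, 0, 0)) (norm5 'F_5)
       == 1 %[mod 5])) all5) all5) all5) all5 by vm_compute.
move/allP/(_ a (all5P a))/allP/(_ b (all5P b))/allP/(_ c (all5P c))/allP.
by move/(_ d (all5P d)).
Qed.

Definition red5 (x : int * int * int * int) : 'F_5 * 'F_5 * 'F_5 * 'F_5 :=
  let: (a, b, c, d) := x in (a%:~R, b%:~R, c%:~R, d%:~R).

Lemma qsqnormM (R : comPzRingType) (x y : R * R * R * R) :
  qsqnorm (qmul x y) = qsqnorm x * qsqnorm y.
Proof. by case: x y => [[[a b] c] d] [[[a' b'] c'] d'] /=; ring. Qed.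

Definition qscale (R : pzRingType) (k : R) (x : R * R * R * R) : R * R * R * R :=
  let: (a, b, c, d) := x in (k * a, k * b, k * c, k * d).

Lemma qsqnormZ (R : comPzRingType) (k : R) x :
  qsqnorm (qscale k x) = k ^+ 2 * qsqnorm x.
Proof. by case: x => [[[a b] c] d] /=; ring. Qed.

Lemma qmulZl (R : comPzRingType) (k : R) x y :
  qmul (qscale k x) y = qscale k (qmul x y).
Proof.
by case: x y => [[[a b] c] d] [[[a' b'] c'] d'] /=; congr (_, _, _, _); ring.
Qed.

Lemma qscale5_inj : injective (@qscale int 5).
Proof.
move=> [[[a b] c] d] [[[a' b'] c'] d'] /= [] h1 h2 h3 h4.
by congr (_, _, _, _); lia.
Qed.

Lemma qmul_conj (R : comPzRingType) (x y : R * R * R * R) :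
  qmul (qmul x (qconj y)) y = qscale (qsqnorm y) x.
Proof.
by case: x y => [[[a b] c] d] [[[a' b'] c'] d'] /=; congr (_, _, _, _); ring.
Qed.

Lemma qconjK (R : comPzRingType) (x : R * R * R * R) : qconj (qconj x) = x.
Proof. by case: x => [[[a b] c] d] /=; rewrite !opprK. Qed.

Lemma qsqnorm_conj (R : comPzRingType) (x : R * R * R * R) :
  qsqnorm (qconj x) = qsqnorm x.
Proof. by case: x => [[[a b] c] d] /=; ring. Qed.

Lemma red5M x y : red5 (qmul x y) = qmul (red5 x) (red5 y).
Proof.
case: x y => [[[a b] c] d] [[[a' b'] c'] d'] /=.
by rewrite !(intrD, intrM, intrN).
Qed.

Lemma red5_sqnorm x : qsqnorm (red5 x) = (qsqnorm x)%:~R.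
Proof. by case: x => [[[a b] c] d] /=; rewrite !intrD !expr2 !intrM. Qed.

Lemma red5_norm5 : map red5 (norm5 int) = norm5 'F_5.
Proof. by apply/eqP; vm_compute. Qed.

Lemma norm5_sqnorm p : p \in norm5 int -> qsqnorm p = 5.
Proof. by rewrite !inE => /or4P [/eqP->|/eqP->|/eqP->|/or3P [/eqP->|/eqP->|/eqP->]]. Qed.

Lemma red5_scale x : red5 (qscale 5 x) = (0, 0, 0, 0).
Proof.
case: x => [[[a b] c] d] /=.
by rewrite !intrM (_ : 5%:~R = 0 :> 'F_5) ?mul0r //; apply/eqP.
Qed.

Lemma red5_eq0 x : red5 x = (0, 0, 0, 0) -> exists y, x = qscale 5 y.
Proof.
have dvd5 (z : int) : z%:~R = 0 :> 'F_5 -> exists t, z = 5 * t.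
  move/eqP; rewrite -(dvdz_pcharf (pchar_Fp (isT : prime 5))).
  by move/dvdzP => [t ->]; exists t; rewrite mulrC.
case: x => [[[a b] c] d] [] /dvd5 [a' ->] /dvd5 [b' ->] /dvd5 [c' ->] /dvd5 [d' ->].
by exists (a', b', c', d').
Qed.

Definition quads (n : nat) : seq (int * int * int * int) :=
  [seq (x, d) | x <- [seq (x, c) | x <- [seq (a, b) | a <- zrange n, b <- zrange n],
                                   c <- zrange n], d <- zrange n].

Lemma mem_quads n a b c d : ((a, b, c, d) \in quads n) =
  [&& `|a| <= n, `|b| <= n, `|c| <= n & `|d| <= n]%N.
Proof.
have pairs (S T : eqType) (s : seq S) (t : seq T) x y :
    ((x, y) \in [seq (x, y) | x <- s, y <- t]) = (x \in s) && (y \in t).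
  apply/allpairsP/andP => [[[x' y'] /= [hx hy [-> ->]]] //|[hx hy]].
  by exists (x, y).
by rewrite !pairs !mem_zrange -!andbA.
Qed.

Lemma quads_uniq n : uniq (quads n).
Proof.
have pairs (S T : eqType) (s : seq S) (t : seq T) :
    uniq s -> uniq t -> uniq [seq (x, y) | x <- s, y <- t].
  by move=> us ut; apply: allpairs_uniq => // -[? ?] [? ?].
by rewrite /quads !pairs ?zrange_uniq.
Qed.

(** The box of radius n makes this a finite list; for i <= n it holds every representation, so its
    size is r_4(i). *)
Definition four_squares (n i : nat) := [seq x <- quads n | qsqnorm x == i%:Z].

Lemma mem_four_squares n i x : (i <= n)%N ->
  (x \in four_squares n i) = (qsqnorm x == i%:Z).
Proof.
case: x => [[[a b] c] d] hi; rewrite mem_filter mem_quads /=.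
apply: andb_idr => /eqP h; apply/and4P; split; nia.
Qed.

Definition mul_dvd5 (p x : int * int * int * int) : bool :=
  red5 (qmul x p) == (0, 0, 0, 0).

(** Right multiplication by the conjugate of p maps norm i bijectively onto the x of norm 5i with x
    p divisible by 5; the inverse is x |-> x p / 5. *)
Lemma count_right_multiples n i p : p \in norm5 int -> (5 * i <= n)%N ->
  count (mul_dvd5 p) (four_squares n (5 * i)) =
  size (four_squares n i).
Proof.
move=> /norm5_sqnorm hp hi; have hi' : (i <= n)%N by lia.
rewrite -size_filter -[RHS](size_map (fun y => qmul y (qconj p))); apply/esym/perm_size.
apply: uniq_perm.
- rewrite map_inj_in_uniq ?filter_uniq ?quads_uniq // => x y _ _.
  by move/(congr1 (fun z => qmul z p)); rewrite !qmul_conj hp => /qscale5_inj.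
- by rewrite !filter_uniq ?quads_uniq.
move=> x; rewrite mem_filter mem_four_squares //; apply/mapP/andP => [[y]|[/eqP]].
  rewrite mem_four_squares // => /eqP hy ->.
  rewrite /mul_dvd5 qmul_conj qsqnormM qsqnorm_conj hy hp red5_scale; split=> //.
  by apply/eqP; lia.
move/red5_eq0 => [y hy] /eqP hx; exists y.
  have := qsqnormM x p; rewrite hy hx hp qsqnormZ mem_four_squares // => h.
  by apply/eqP; move: (qsqnorm y) h => N; lia.
(* With x p = 5 y, multiplying by the conjugate of p gives 5 x = 5 (y [qconj p]). *)
have := qmul_conj x (qconj p); rewrite qconjK qsqnorm_conj hy hp qmulZl.
by move/qscale5_inj.
Qed.

(* If 5 divides the norm of x, then x p = 0 mod 5 for exactly one of the six
   p in [norm5], or for all six when x = 0 mod 5: one mod 5 in both cases. *)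
Lemma four_squares_mod5 n i : (5 * i <= n)%N ->
  size (four_squares n (5 * i)) = size (four_squares n i) %[mod 5].
Proof.
move=> hi.
have h : (\sum_(p <- norm5 int) count (mul_dvd5 p) (four_squares n (5 * i)) =
          \sum_(p <- norm5 int) size (four_squares n i))%N.
  rewrite big_seq [RHS]big_seq; apply: eq_bigr => p hp.
  exact: count_right_multiples.
have h6 : (\sum_(p <- norm5 int) size (four_squares n i) =
           size (four_squares n i) + 5 * size (four_squares n i))%N.
  by rewrite !big_cons big_nil; lia.
rewrite -[RHS](modnMDl (size (four_squares n i))) [(_ * 5)%N]mulnC addnC -h6 -h.
(* Double counting: sum over x first, then over the p with x p = 0 mod 5. *)
under eq_bigr do rewrite -sum1_count big_mkcond.
rewrite exchange_big /= -sum1_size.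
have hx x : x \in four_squares n (5 * i) ->
    (\sum_(p <- norm5 int) (if mul_dvd5 p x then 1 else 0) = 1 %[mod 5])%N.
  move=> hx; rewrite -big_mkcond sum1_count.
  have hn : qsqnorm (red5 x) = 0.
    move: hx; rewrite mem_four_squares // red5_sqnorm => /eqP ->.
    by apply/eqP; rewrite -(dvdz_pcharf (pchar_Fp (isT : prime 5))); lia.
  have e : mul_dvd5^~ x =1
      preim red5 (fun p => qmul (red5 x) p == (0%R, 0%R, 0%R, 0%R)).
    by move=> p; rewrite /mul_dvd5 red5M.
  rewrite (eq_count e) -count_map red5_norm5; exact: count_norm5.
rewrite big_seq [in RHS]big_seq.
elim/big_ind2: _ => // [a b c d hac hbd|x /hx -> //].
by rewrite -modnDm hac hbd modnDm.
Qed.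

(** * The congruence *)

Lemma theta4_coef (R : comNzRingType) n i :
  (theta R n ^+ 4)`_i = (-1) ^+ i * (size (four_squares n i))%:R.
Proof.
have -> : theta R n ^+ 4 = \sum_(x <- quads n) let: (a, b, c, d) := x in
    (-1) ^+ (`|a| + `|b| + `|c| + `|d|) *
    'X^(`|a| ^ 2 + `|b| ^ 2 + `|c| ^ 2 + `|d| ^ 2).
  have mul_pairs (S T : Type) (s : seq S) (t : seq T) (f : S -> {poly R}) g :
      (\sum_(x <- s) f x) * (\sum_(y <- t) g y) =
      \sum_(z <- [seq (x, y) | x <- s, y <- t]) f z.1 * g z.2.
    by rewrite big_distrlr big_allpairs_dep.
  rewrite !exprSr expr0 mul1r /theta !mul_pairs.
  by apply: eq_bigr => -[[[a b] c] d] _ /=; rewrite !exprD; ring.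
rewrite coef_sum -sum1_size big_filter natr_sum mulr_sumr [RHS]big_mkcond /=.
apply: eq_bigr => -[[[a b] c] d] _; rewrite -polyC1 -polyCN -polyC_exp coefCM coefXn.
have sqrz (z : int) : z ^+ 2 = (`|z| ^ 2)%:Z by rewrite -mulnn PoszM; case: (intP z).
rewrite /= !sqrz -!PoszD eqz_nat eq_sym; case: eqP => [<-|_]; last by rewrite mulr0.
(* An integer and its square have the same parity, so the sign depends only on i. *)
by rewrite !mulr1 -[LHS]signr_odd -[RHS]signr_odd !oddD !oddX.
Qed.

Lemma three_squares_mod8 (a b c : nat) : ((a ^ 2 + b ^ 2 + c ^ 2) %% 8 != 7)%N.
Proof.
have h (x : nat) : [|| x ^ 2 %% 8 == 0, x ^ 2 %% 8 == 1 | x ^ 2 %% 8 == 4]%N.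
  rewrite -modnXm; have := ltn_pmod x (isT : 0 < 8)%N.
  by move: (x %% 8)%N; do 8?case=> //.
move: (h a) (h b) (h c); move: (a ^ 2)%N (b ^ 2)%N (c ^ 2)%N => A B C; lia.
Qed.

Lemma theta3_coef (R : comNzRingType) n m : (theta R n ^+ 3)`_(8 * m + 7) = 0.
Proof.
rewrite !exprSr expr0 mul1r /theta !big_distrlr /= coef_sum big1 // => a _.
rewrite coef_sum big1 // => c _; rewrite big_distrl /= coef_sum big1 // => b _.
have -> : (-1) ^+ `|a| * 'X^(`|a| ^ 2) * ((-1) ^+ `|b| * 'X^(`|b| ^ 2)) *
    ((-1) ^+ `|c| * 'X^(`|c| ^ 2)) =
    (-1) ^+ (`|a| + `|b| + `|c|) * 'X^(`|a| ^ 2 + `|b| ^ 2 + `|c| ^ 2) :> {poly R}.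
  by rewrite !exprD; ring.
rewrite -polyC1 -polyCN -polyC_exp coefCM coefXn.
case: eqP => [h|]; last by rewrite mulr0.
have := three_squares_mod8 `|a| `|b| `|c|; rewrite -h.
by rewrite mulnC modnMDl.
Qed.

Lemma dissect_opoly K n : (10 * K <= n)%N ->
  eq_trunc K (dissect 5 (opoly 'F_5 (5 * K) n)) (theta 'F_5 n ^+ 3).
Proof.
move=> hn; set P := opoly _ _ _; set T := theta _ _.
have TP : eq_trunc (5 * K) (T * P) 1 by apply: theta_opoly; lia.
case: (posnP K) => [->//|K0].
have T0 : T`_0 = 1.
  have := TP 0%N; rewrite coef0M coef1 [P`_0]coef_poly opartsn0.
  by rewrite (_ : (0 < 5 * K)%N = true) ?mulr1; [apply; lia | lia].
(* P T(X^5) = P T^5 = T^4, since P T = 1. *)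
have T4 : eq_trunc (5 * K) (P * (T \Po 'X^5)) (T ^+ 4).
  rewrite -theta_frobenius // mulrC exprSr -mulrA -[X in eq_trunc _ _ X]mulr1.
  exact: eq_truncMl.
(* After multiplication by T, dissecting [T4] reduces the goal to: T^4 and its dissection agree in
   degrees below K. *)
apply: (eq_trunc_cancel T0); rewrite -exprS mulrC -dissectM // => i hi.
rewrite coef_dissect // T4; last by lia.
rewrite !theta4_coef; congr (_ * _).
  by rewrite -signr_odd -[RHS]signr_odd oddM.
have h : (size (four_squares n (5 * i)) = size (four_squares n i) %[mod 5])%N.
  by apply: four_squares_mod5; lia.
by move/(congr1 (fun k => k%:R : 'F_5)): h; rewrite !Fp_nat_mod.
Qed.

Local Close Scope ring_scope.

Theorem theorem3p1 (n : nat) : pbar (40 * n + 35) %% 5 = 0.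
Proof.
(* K = 8n+8 is the least bound covering degree 8n+7; the part bound 10K exceeds 5(8n+7), so [oparts]
   there equals [pbar]. *)
have := @dissect_opoly (8 * n + 8) (10 * (8 * n + 8)) (leqnn _) (8 * n + 7).
rewrite theta3_coef coef_dissect // coef_poly => h; move: h.
rewrite (_ : (5 * _ < _) = true); last lia.
rewrite oparts_ge; last lia.
move/(_ _)/eqP; rewrite -(dvdn_pcharf (pchar_Fp (isT : prime 5))) => h.
apply/eqP; have -> : 40 * n + 35 = 5 * (8 * n + 7) by lia.
apply: h; lia.
Qed.
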